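(* No infinite abelian group satisfies property $P_2$. Consequently, for every integer $k\ge 2$, no infinite abelian group satisfies property $P_k$.
   Context: For a group $G$, $\mathcal{L}_G$ denotes the complete lattice of all (not necessarily Hausdorff) group topologies on $G$, ordered by inclusion ($\tau\le\sigma$ iff $\tau\subseteq\sigma$), and $\tau_d$ is the discrete topology, its greatest element. For chains $C,D$ in a poset $(P,\le)$, $C$ refines $D$ if $D\subseteq C$ and every $c\in C$ satisfies $d_1\le c\le d_2$ for some $d_1,d_2\in D$; a chain is non-refinable if it has no proper refinement (a refinement different from itself). A finite chain with $n+1$ elements has length $n$. For a positive integer $k$, a Hausdorff group topology $\tau$ on $G$ is $k$-maximal if every non-refinable chain in $\mathcal{L}_G$ from $\tau$ to $\tau_d$ (i.e. with least element $\tau$ and greatest element $\tau_d$) has length exactly $k$. $\mathcal{A}_k(G)$ denotes the set of all $k$-maximal topologies on $G$. The group $G$ satisfies property $P_k$ if every infinite non-refinable chain in $\mathcal{L}_G$ that consists of Hausdorff group topologies and terminates at the discrete topology (has $\tau_d$ as its greatest element) intersects $\mathcal{A}_k(G)$. *)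

(* Defs.v *)
From HB Require Import structures.
From mathcomp Require Import all_boot all_order all_algebra.
From mathcomp Require Import all_classical all_reals all_analysis.
Set Implicit Arguments.
Unset Strict Implicit.
Unset Printing Implicit Defensive.
Import Order.TTheory GRing.Theory.
Local Open Scope classical_set_scope.

(* The empty set is open as the union of the empty family. *)
Definition is_topology (T : Type) (tau : set (set T)) : Prop :=
  [/\ tau setT,
      setI_closed tau &
      forall F : set (set T), F `<=` tau -> tau (\bigcup_(U in F) U)].

Record topology (T : Type) := Topology {
  opens :> set (set T);
  opensP : `[< is_topology opens >] }.

HB.instance Definition _ (T : Type) := [isSub for @opens T].
HB.instance Definition _ (T : Type) := [Choice of topology T by <:].
HB.instance Definition _ (T : Type) :=
  [SubChoice_isSubPOrder of topology T by <: with set_display].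

Lemma topology_le (T : Type) (tau sigma : topology T) :
  (tau <= sigma)%O <-> opens tau `<=` opens sigma.
Proof. by rewrite -subsetEset. Qed.

(* T equipped with tau as a library topological space. *)
Definition space (T : Type) (tau : topology T) : Type := T.

Section Space.
Variables (T : choiceType) (tau : topology T).

Let opT : opens tau setT.
Proof. by have /asboolP[] := opensP tau. Qed.

Let opI : setI_closed (opens tau).
Proof. by have /asboolP[] := opensP tau. Qed.

Let op_bigU (I : Type) (f : I -> set T) :
  (forall i, opens tau (f i)) -> opens tau (\bigcup_i f i).
Proof.
move=> of_; have /asboolP[_ _ opU] := opensP tau.
have -> : \bigcup_i f i = \bigcup_(U in range f) U.
  by rewrite bigcup_image.
by apply: opU => _ [i _ <-].
Qed.

HB.instance Definition _ := Choice.on (space tau).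
HB.instance Definition _ :=
  isOpenTopological.Build (space tau) opT opI op_bigU.

Lemma space_openE : @open (space tau) = opens tau.
Proof. by []. Qed.

End Space.

HB.instance Definition _ (G : zmodType) (tau : topology G) :=
  GRing.Zmodule.on (space tau).

Definition is_group_topology (G : zmodType) (tau : topology G) : Prop :=
  continuous (fun p : space tau * space tau => (p.1 + p.2)%R) /\
  continuous (fun x : space tau => (- x)%R).

Record group_topology (G : zmodType) := GroupTopology {
  gt_topology :> topology G;
  gt_topologyP : `[< is_group_topology gt_topology >] }.

HB.instance Definition _ (G : zmodType) := [isSub for @gt_topology G].
HB.instance Definition _ (G : zmodType) := [Choice of group_topology G by <:].
HB.instance Definition _ (G : zmodType) :=
  [SubChoice_isSubPOrder of group_topology G by <: with set_display].

Lemma group_topology_le (G : zmodType) (tau sigma : group_topology G) :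
  (tau <= sigma)%O <-> opens tau `<=` opens sigma.
Proof. by rewrite -topology_le. Qed.

Definition gt_hausdorff (G : zmodType) (tau : group_topology G) : Prop :=
  hausdorff_space (space tau).

Section Discrete.
Variable G : zmodType.

Let discrete_topP : `[< is_topology [set: set G] >].
Proof. exact/asboolP. Qed.

Let discrete_top : topology G := Topology discrete_topP.

Let nbhs_set1 (x : space discrete_top) : nbhs x [set x].
Proof. by apply: open_nbhs_nbhs; split. Qed.

Let discrete_gtP : `[< is_group_topology discrete_top >].
Proof.
apply/asboolP; split.
  move=> [x y] U /nbhs_singleton Uxy.
  exists ([set x], [set y]); first by split; exact: nbhs_set1.
  by move=> [a b] [/= -> ->].
move=> x U /nbhs_singleton Ux.
by apply: filterS (nbhs_set1 x) => a ->.
Qed.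

Definition gt_discrete : group_topology G := GroupTopology discrete_gtP.

Lemma gt_discreteE : opens gt_discrete = setT.
Proof. by []. Qed.

Lemma le_gt_discrete (tau : group_topology G) : (tau <= gt_discrete)%O.
Proof. exact/group_topology_le. Qed.

End Discrete.
Arguments gt_discrete : clear implicits.

Section Chains.
Context {d : Order.disp_t} {P : porderType d}.
Implicit Types (C D : set P) (x : P) (n : nat).

Definition chain C : Prop := total_on C (fun x y => (x <= y)%O).

Definition refines C D : Prop :=
  D `<=` C /\
  forall c, C c -> exists d1 d2, [/\ D d1, D d2, (d1 <= c)%O & (c <= d2)%O].

Definition nonrefinable_chain D : Prop :=
  chain D /\ forall C, chain C -> refines C D -> C = D.

Definition has_least C x : Prop := C x /\ lbound C x.

Definition has_greatest C x : Prop := C x /\ ubound C x.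

Definition has_length C n : Prop := (C #= `I_n.+1)%card.

End Chains.

Definition kmaximal (G : zmodType) (k : nat) : set (group_topology G) :=
  [set tau | gt_hausdorff tau /\
    forall C : set (group_topology G),
      nonrefinable_chain C -> has_least C tau ->
      has_greatest C (gt_discrete G) -> has_length C k].

Definition property_P (G : zmodType) (k : nat) : Prop :=
  forall C : set (group_topology G),
    infinite_set C -> nonrefinable_chain C ->
    (forall tau, C tau -> gt_hausdorff tau) ->
    has_greatest C (gt_discrete G) ->
    C `&` @kmaximal G k !=set0.

(* Main.v *)
Require Import Defs.
From mathcomp Require Import all_boot all_order all_algebra.
From mathcomp Require Import all_classical all_reals all_analysis.
From mathcomp Require Import zify ring lra.
Set Implicit Arguments.
Unset Strict Implicit.
Unset Printing Implicit Defensive.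
Import Order.TTheory GRing.Theory Num.Theory.
Local Open Scope ring_scope.
Local Open Scope classical_set_scope.

(** Write [t] for the discrete topology. A nonrefinable chain [C] contains no
    [k]-maximal topology with [2 <= k] as soon as it contains a coatom [s] of
    the lattice of group topologies that is the supremum of the elements of
    [C] strictly below it and is not the successor of any of them: the part of
    [C] above an element [x] is a nonrefinable chain from [x] to [t], and it
    has at most two elements if [x] is [s] or [t], and infinitely many if [x]
    is below [s] ([exists_chain_without_kth_top]). A maximal chain of
    Hausdorff topologies through [s] has this shape once we know a chain [D] of
    Hausdorff topologies strictly below [s] whose supremum is [s]
    ([exists_limit_coatom]).

    To find [s] and [D], identify a group topology with its filter of
    neighbourhoods of [0]; a filter on [G] arises in this way iff it is a
    [group_filter], and inclusion of topologies is inclusion of filters.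

    - Every infinite abelian group has a nondiscrete Hausdorff group filter [R]
      with a countable base ([exists_nondiscrete_group_filter]). The
      characters of [G] into the rationals modulo the integers separate points,
      because their target is divisible. On an infinite countable subgroup,
      countably many of them suffice to define [R]. It is not discrete, by the
      pigeonhole principle. Zorn's lemma enlarges [R] to a maximal nondiscrete
      group filter [S], which is the coatom [s].

    - The filter [S] has no countable base ([maximal_not_countable_base]): a
      metrizable nondiscrete group topology can be refined strictly and
      without becoming discrete, by forcing a very sparse sequence to converge
      to [0] ([sparse_refinement]).

    - A filter [S] without countable base is the union of a chain of group
      filters strictly between [R] and [S] ([exists_chain_below]). Indeed [S]
      is the directed union of group filters with a countable base, each
      different from [S], so it is not a compact element above [R]; that the
      directed family can be traded for a chain is a general fact about
      lattices, obtained here from Zorn's lemma without well-orderings. *)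

(** * Zorn's lemma and decreasing sequences of sets *)

(** Zorn's lemma above a given element; asking only for unions of nonempty
    chains spares a separate treatment of the empty set. *)
Lemma Zorn_above (T : Type) (P : set (set T)) (A0 : set T) :
    P A0 ->
    (forall F : set (set T), F `<=` P -> F !=set0 -> total_on F subset ->
      P (\bigcup_(X in F) X)) ->
  exists A, [/\ P A, A0 `<=` A & forall B, P B -> A `<=` B -> B = A].
Proof.
move=> PA0 Pcup; pose P' A := P (A0 `|` A).
have [F FP' Ftot|A [PA maxA]] := @Zorn_bigcup T P'.
  have [[X FX]|F0] := pselect (F !=set0); last first.
    rewrite /P'; suff -> : A0 `|` \bigcup_(X in F) X = A0 by [].
    apply/seteqP; split=> [x [//|[X FX _]]|x]; last by left.
    by case: F0; exists X.
  have -> : P' (\bigcup_(X in F) X) =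
      P (\bigcup_(Y in [set A0 `|` X | X in F]) Y).
    congr P; apply/seteqP; split=> x.
      by case=> [A0x|[Y FY Yx]]; [exists (A0 `|` X)|exists (A0 `|` Y)];
        [exists X|left|exists Y|right].
    by case=> _ [Y FY <-] [A0x|Yx]; [left|right; exists Y].
  apply: Pcup.
  - by move=> _ [Y FY <-]; exact: FP'.
  - by exists (A0 `|` X); exists X.
  - move=> _ _ [Y FY <-] [Z FZ <-].
    by have [YZ|ZY] := Ftot Y Z FY FZ; [left|right]; exact: setUS.
exists (A0 `|` A); split=> [//||B PB AB]; first exact: subsetUl.
have A0B : A0 `<=` B by move=> x A0x; apply: AB; left.
have AsubB : A `<=` B by move=> x Ax; apply: AB; right.
have P'B : P' B by rewrite /P' setUidr.
apply/seteqP; split=> // x Bx; right; apply: contrapT => nAx.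
by apply: maxA P'B; split=> // BA; exact/nAx/BA.
Qed.

Lemma decreasing_subset (T : Type) (V : nat -> set T) m n :
  (forall k, V k.+1 `<=` V k) -> (m <= n)%N -> V n `<=` V m.
Proof.
move=> VS; elim: n => [|n IH]; first by rewrite leqn0 => /eqP->.
rewrite leq_eqVlt => /predU1P[-> //|]; rewrite ltnS => /IH.
exact: subset_trans.
Qed.

(** * Group filters *)

Section GroupFilters.
Context {G : zmodType}.
Implicit Types (M N L S R : set (set G)) (U V : set G).

(** The filters of neighbourhoods of [0] in the group topologies on [G].
    Subtraction alone handles both operations, as every member contains
    [0]. *)
Definition group_filter N : Prop :=
  [/\ Filter N,
      forall U, N U -> U 0 &
      forall U, N U -> exists2 V, N V & forall x y, V x -> V y -> U (x - y)].

Lemma group_filterB N U : group_filter N -> N U ->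
  exists V, [/\ N V, V `<=` U & forall x y, V x -> V y -> U (x - y)].
Proof.
move=> [FN N0 NB] NU; have [V NV VU] := NB U NU; exists V; split=> // x Vx.
by rewrite -[x]subr0; apply: VU => //; exact: N0.
Qed.

Lemma group_filterBD N U : group_filter N -> N U ->
  exists2 V, N V & forall x y, V x -> V y -> U (x - y) /\ U (x + y).
Proof.
move=> gN NU; have [FN N0 _] := gN.
have [V [NV VU VB]] := group_filterB gN NU.
have [W [NW WV WB]] := group_filterB gN NV.
exists W => // x y Wx Wy; split; first exact/VU/WB.
rewrite -[y]opprK; apply: VB; first exact: WV.
by rewrite -[- y]sub0r; apply: WB => //; exact: N0.
Qed.

(** The supremum of two group filters in the lattice of group topologies:
    finite intersections of neighbourhoods suffice. *)
Definition fjoin M N : set (set G) :=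
  [set A | exists B C, [/\ M B, N C & B `&` C `<=` A]].

Lemma fjoin_group_filter M N :
  group_filter M -> group_filter N -> group_filter (fjoin M N).
Proof.
move=> [FM M0 MB] [FN N0 NB]; split.
- split.
  + by exists setT, setT; split=> //; exact: filterT.
  + move=> P Q [B [C [MB1 NC1 s1]]] [B' [C' [MB2 NC2 s2]]].
    exists (B `&` B'), (C `&` C'); split; [exact: filterI|exact: filterI|].
    by move=> x [[? ?] [? ?]]; split; [apply: s1|apply: s2].
  + move=> A A' AA' [B [C [MB1 NC1 s1]]]; exists B, C; split=> //.
    exact: subset_trans AA'.
- by move=> A [B [C [MB1 NC1]]]; apply; split; [exact: M0|exact: N0].
- move=> A [B [C [MB1 NC1 s1]]].
  have [B' MB' B'B] := MB _ MB1; have [C' NC' C'C] := NB _ NC1.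
  exists (B' `&` C'); first by exists B', C'; split.
  by move=> x y [? ?] [? ?]; apply: s1; split; [apply: B'B|apply: C'C].
Qed.

Lemma fjoinl M N : Filter N -> M `<=` fjoin M N.
Proof.
by move=> FN U MU; exists U, setT; rewrite setIT; split=> //; exact: filterT.
Qed.

Lemma fjoinr M N : Filter M -> N `<=` fjoin M N.
Proof.
by move=> FM U NU; exists setT, U; rewrite setTI; split=> //; exact: filterT.
Qed.

Lemma fjoin_sub M N L : Filter L -> M `<=` L -> N `<=` L -> fjoin M N `<=` L.
Proof.
move=> FL ML NL A [B [C [/ML LB /NL LC s]]].
by apply: (filterS s); exact: filterI.
Qed.

Lemma fjoinS M M' N : M `<=` M' -> fjoin M N `<=` fjoin M' N.
Proof. by move=> MM' A [B [C [/MM' ? ? ?]]]; exists B, C. Qed.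

(** Suprema of chains in the lattice of group topologies are plain unions of
    neighbourhood filters. *)
Lemma bigcup_group_filter (F : set (set (set G))) :
    (forall M, F M -> group_filter M) -> F !=set0 -> total_on F subset ->
  group_filter (\bigcup_(M in F) M).
Proof.
move=> gF [M0 FM0] Ftot; split.
- split.
  + by exists M0 => //; have [? _ _] := gF _ FM0; exact: filterT.
  + move=> P Q [M FM MP] [N FN NQ].
    have [MN|NM] := Ftot M N FM FN.
    * by exists N => //; have [? _ _] := gF _ FN; apply: filterI; first exact: MN.
    * by exists M => //; have [? _ _] := gF _ FM; apply: filterI=> //; exact: NM.
  + move=> P Q PQ [M FM MP]; exists M => //.
    by have [? _ _] := gF _ FM; exact: filterS MP.
- by move=> U [M FM]; have [_ + _] := gF _ FM; apply.
- move=> U [M FM MU]; have [_ _ /(_ U MU)[V MV VU]] := gF _ FM.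
  by exists V => //; exists M.
Qed.

Definition seq_filter (V : nat -> set G) : set (set G) :=
  [set A | exists n, V n `<=` A].

Lemma seq_filter_group_filter (V : nat -> set G) :
    (forall n, V n 0) ->
    (forall n x y, V n.+1 x -> V n.+1 y -> V n (x - y)) ->
  group_filter (seq_filter V).
Proof.
move=> V0 VB.
have VS n : V n.+1 `<=` V n by move=> x Vx; rewrite -[x]subr0; exact: VB.
have Vle m n : (m <= n)%N -> V n `<=` V m by exact: decreasing_subset.
split.
- split.
  + by exists 0%N.
  + move=> P Q [m mP] [n nQ]; exists (maxn m n) => x Vx; split.
      by apply: mP; apply: Vle Vx; exact: leq_maxl.
    by apply: nQ; apply: Vle Vx; exact: leq_maxr.
  + by move=> P Q PQ [m mP]; exists m; exact: subset_trans PQ.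
- by move=> U [n]; apply.
- by move=> U [n nU]; exists (V n.+1); [exists n.+1|move=> x y ? ?; exact/nU/VB].
Qed.

Definition countable_base N : Prop :=
  exists2 V : nat -> set G, (forall n, N (V n)) &
    forall U, N U -> exists n, V n `<=` U.

Lemma seq_filter_countable_base (V : nat -> set G) :
  countable_base (seq_filter V).
Proof. by exists V => // n; exists n. Qed.

Lemma fjoin_countable_base M N :
  countable_base M -> countable_base N -> countable_base (fjoin M N).
Proof.
move=> [V MV Vb] [W NW Wb].
pose ij n := odflt (0%N, 0%N) (unpickle n : option (nat * nat)).
exists (fun n => V (ij n).1 `&` W (ij n).2).
  by move=> n; exists (V (ij n).1), (W (ij n).2); split.
move=> U [B [C [/Vb[i Bi] /Wb[j Cj] s]]].
exists (pickle (i, j)); rewrite /ij pickleK /= => x [/Bi ? /Cj ?].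
exact: s.
Qed.

(** So every group filter is the directed union of the countably based group
    filters that it contains, by [fjoin_countable_base]. Iterate the choice of
    a [V] with [V - V] inside [U]. *)
Lemma countable_sub_filter S U : group_filter S -> S U ->
  exists N, [/\ group_filter N, countable_base N, N `<=` S & N U].
Proof.
move=> gS SU; have [FS S0 SB] := gS.
have /choice[v vP] : forall A, exists B, S A ->
    S B /\ forall x y, B x -> B y -> A (x - y).
  move=> A; have [/SB[B ? ?]|] := pselect (S A); first by exists B.
  by exists setT.
pose V n := iter n v U.
have SV n : S (V n) by elim: n => //= n /vP[].
exists (seq_filter V); split.
- apply: seq_filter_group_filter => [n|n x y]; first exact: S0.
  by have [_] := vP _ (SV n); exact.
- exact: seq_filter_countable_base.
- by move=> A [n VA]; exact: (filterS VA).
- by exists 0%N.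
Qed.

(** Call [N] small if it is a countably based group filter inside [S], and
    consider the [M] between [R] and [S] that no small [N] joins up to [S].
    Suppose that no chain as claimed exists. Then this family is closed under
    unions of chains, since the union of a chain of joins [fjoin M N], all
    different from [S], is different from [S]. A maximal [M] is contained in
    every [fjoin M N] with [N] small, and these are in the family because
    small filters are closed under joins; so [M] contains all small filters,
    that is, all of [S], a contradiction. *)
Lemma exists_chain_below S R :
    group_filter S -> ~ countable_base S ->
    group_filter R -> countable_base R -> R `<=` S ->
  exists D : set (set (set G)),
    [/\ forall M, D M -> [/\ group_filter M, R `<=` M, M `<=` S & M <> S],
        D !=set0, total_on D subset & \bigcup_(M in D) M = S].
Proof.
move=> gS ncS gR cR RS; have [FS _ _] := gS; have [FR _ _] := gR.
apply: contrapT => noD.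
pose small N := [/\ group_filter N, countable_base N & N `<=` S].
pose Q M := [/\ group_filter M, R `<=` M, M `<=` S &
  forall N, small N -> fjoin M N <> S].
have QR : Q R.
  split=> // N [gN cN NS] jS; apply: ncS; rewrite -jS.
  exact: fjoin_countable_base.
have Qcup F : F `<=` Q -> F !=set0 -> total_on F subset ->
    Q (\bigcup_(M in F) M).
  move=> FQ F0 Ftot; have [M0 FM0] := F0.
  have gF M : F M -> group_filter M by move=> /FQ[].
  split.
  - exact: bigcup_group_filter.
  - by move=> U RU; exists M0 => //; have [_ + _ _] := FQ _ FM0; apply.
  - by move=> U [M /FQ[_ _ + _]]; apply.
  - move=> N sN jS; have [gN _ NS] := sN; have [FN _ _] := gN.
    (* a chain of [M]'s whose union joins with [N] up to [S] gives such a [D] *)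
    apply: noD; exists [set fjoin M N | M in F]; split.
    + move=> _ [M FM <-]; have [gM RM MS jM] := FQ _ FM; split.
      * exact: fjoin_group_filter.
      * by apply: subset_trans RM _; exact: fjoinl.
      * exact: fjoin_sub.
      * exact: jM.
    + by exists (fjoin M0 N); exists M0.
    + move=> _ _ [M FM <-] [M' FM' <-].
      by have [?|?] := Ftot M M' FM FM'; [left|right]; exact: fjoinS.
    + rewrite -jS; apply/seteqP; split=> A.
        by move=> [_ [M FM <-] [B [C [? ? ?]]]]; exists B, C; split=> //; exists M.
      move=> [B [C [[M FM MB] NC s]]].
      by exists (fjoin M N); [exists M|exists B, C].
have [M [[gM RM MS jM] _ maxM]] := Zorn_above QR Qcup.
have [FM _ _] := gM.
have [U SU nMU] : exists2 U, S U & ~ M U.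
  apply: contrapT => h; apply: (jM R) => //.
  apply/seteqP; split; first exact: fjoin_sub.
  move=> U SU; apply: fjoinl; apply: contrapT => nMU.
  by apply: h; exists U.
have [N [gN cN NS NU]] := countable_sub_filter gS SU.
have [FN _ _] := gN.
apply: nMU; rewrite -(maxM (fjoin M N)); first exact: fjoinr.
- split; first exact: fjoin_group_filter.
  + by apply: subset_trans RM _; exact: fjoinl.
  + exact: fjoin_sub.
  + move=> N' [gN' cN' N'S] jS; have [FN' _ _] := gN'.
    have [FNN' _ _] := fjoin_group_filter gN gN'.
    apply: (jM (fjoin N N')).
      split; [exact: fjoin_group_filter|exact: fjoin_countable_base|].
      exact: fjoin_sub.
    have gNN' := fjoin_group_filter gN gN'.
    apply/seteqP; split; first by apply: fjoin_sub => //; exact: fjoin_sub.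
    have [FM' _ _] := fjoin_group_filter gM gNN'.
    rewrite -{1}jS; apply: fjoin_sub; first apply: fjoin_sub.
    * exact: fjoinl.
    * by apply: subset_trans (fjoinr _); exact: fjoinl.
    * by apply: subset_trans (fjoinr _); exact: fjoinr.
- exact: fjoinl.
Qed.

End GroupFilters.

(** * A maximal nondiscrete group filter has no countable base *)

Definition int_range (n : nat) : seq int :=
  [seq k%:Z | k <- iota 0 n.+1] ++ [seq - k%:Z | k <- iota 0 n.+1].

Lemma mem_int_range n (c : int) : (`|c| <= n)%N -> c \in int_range n.
Proof.
move=> cn; rewrite mem_cat; apply/orP.
have kn : `|c|%N \in iota 0 n.+1 by rewrite mem_iota.
case: (lerP 0 c) => c0; [left|right]; apply/mapP; exists `|c|%N => //.
  by rewrite gez0_abs.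
by rewrite ltz0_abs// opprK.
Qed.

(** Here [W] is a countable base at [0] of a nondiscrete Hausdorff group
    topology. *)
Section SparseRefinement.
Context {G : zmodType} (W : nat -> set G).
Hypothesis W0 : forall n, W n 0.
Hypothesis WB : forall n x y, W n.+1 x -> W n.+1 y -> W n (x - y).
Hypothesis WD : forall n x y, W n.+1 x -> W n.+1 y -> W n (x + y).
Hypothesis Wsep : forall x, (forall n, W n x) -> x = 0.
Hypothesis Wnd : forall n, exists2 x, W n x & x <> 0.

Let W_le m n : (m <= n)%N -> W n `<=` W m.
Proof.
apply: decreasing_subset => k x Wx; rewrite -[x]subr0; exact: WB.
Qed.

Let W_avoid (E : seq G) : 0 \notin E ->
  exists k, forall e, e \in E -> ~ W k e.
Proof.
elim: E => [|e E IH]; first by exists 0%N.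
rewrite inE negb_or => /andP[e0 /IH[k kE]].
have [j nWj] : exists j, ~ W j e.
  apply: contrapT => /forallNP h; move/eqP: e0; apply; apply/esym/Wsep => n.
  exact: contrapT (h n).
exists (maxn k j) => x; rewrite inE => /predU1P[->|xE] Wx.
  by apply: nWj; apply: W_le Wx; exact: leq_maxr.
by apply: (kE x) => //; apply: W_le Wx; exact: leq_maxl.
Qed.

Let W_infinite m (E : seq G) : exists2 b, W m b & b \notin E.
Proof.
apply: contrapT => h.
have WE b : W m b -> b \in E.
  by move=> Wb; apply: contrapT => /negP bE; apply: h; exists b.
have [|k kE] := W_avoid (E := [seq e <- E | e != 0]).
  by rewrite mem_filter eqxx.
have [x Wx x0] := Wnd (maxn m k).
apply: (kE x).
  rewrite mem_filter; apply/andP; split; first exact/eqP.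
  by apply: WE; apply: W_le Wx; exact: leq_maxl.
by apply: W_le Wx; exact: leq_maxr.
Qed.

Let W_mulz p n x (c : int) : W (p + n.+1) x -> (`|c| <= n)%N -> W p (x *~ c).
Proof.
have Wn k q : W (q + k) x -> W q (x *+ k).
  elim: k q => [|k IH] q Wx; first by rewrite mulr0n.
  rewrite mulrS; apply: WD; last by apply: IH; rewrite addSnnS.
  by apply: W_le Wx; rewrite addnS ltnS leq_addr.
move=> Wx cn; have Wc : W p.+1 (x *+ `|c|%N).
  by apply: Wn; apply: W_le Wx; lia.
case: c cn Wc => k kn; first by move/W_le; apply.
by move=> Wc; rewrite NegzE mulrNz -[- _]sub0r; apply: WB.
Qed.

(** One step of the construction of a sparse sequence. The list [s.1] holds
    the combinations of the terms chosen so far; the point [b] of [W s.2]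
    avoids them, and the new term [t.1] is so small that later combinations,
    which will lie in [W t.2], cannot correct a member of [s.1] into [b]. *)
Let step n (s : seq G * nat) : exists t : G * nat,
  [/\ t.1 <> 0, (s.2 < t.2)%N,
      exists2 b, W s.2 b & forall e, e \in s.1 -> ~ W t.2 (b - e) &
      forall c : int, (`|c| <= 2 ^ n)%N -> W t.2.+1 (t.1 *~ c)].
Proof.
case: s => E m /=; have [b Wb bE] := W_infinite m E.
have [|k kE] := W_avoid (E := [seq b - e | e <- E]).
  apply/negP => /mapP[e eE /esym/eqP]; rewrite subr_eq0 => /eqP be.
  by rewrite be eE in bE.
pose m' := maxn m.+1 k.
have [a Wa a0] := Wnd (m'.+1 + (2 ^ n).+1).
exists (a, m'); split=> //=.
- exact: leq_maxl.
- exists b => // e eE We; apply: (kE (b - e)); first exact: map_f.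
  by apply: W_le We; exact: leq_maxr.
- by move=> c; exact: W_mulz.
Qed.

(** A strictly finer nondiscrete group topology. For the sparse sequence [a]
    let [U k] be the set of finite sums of the [a i *~ c i] with
    [`|c i| * 2 ^ k <= 2 ^ i]. Then [U k.+1 - U k.+1] lies in [U k], the
    terms with [i < k] vanish, and [a k] belongs to [U k]. Every [W n] has a
    point [b] outside [U 0]: the first terms of a sum in [U 0] cannot come
    close to [b], and the remaining ones are too small to make up the
    difference. *)
Lemma sparse_refinement : exists U : nat -> set G,
  [/\ forall n, U n 0,
      forall n x y, U n.+1 x -> U n.+1 y -> U n (x - y),
      forall n, U n `<=` W n,
      forall n, exists2 x, U n x & x <> 0 &
      forall n, exists2 x, W n x & ~ U 0%N x].
Proof.
have /choice[f fP] : forall ns : nat * (seq G * nat), exists t : G * nat,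
    [/\ t.1 <> 0, (ns.2.2 < t.2)%N,
      exists2 b, W ns.2.2 b & forall e, e \in ns.2.1 -> ~ W t.2 (b - e) &
      forall c : int, (`|c| <= 2 ^ ns.1)%N -> W t.2.+1 (t.1 *~ c)].
  by case=> n s; exact: step.
pose st := fix st n : seq G * nat := if n is k.+1 then
  let t := f (k, st k) in
  ([seq e + t.1 *~ c | e <- (st k).1, c <- int_range (2 ^ k)], t.2)
  else ([:: 0], 0%N).
pose a n := (f (n, st n)).1; pose m n := (st n).2.
have a0 n : a n <> 0 by have [] := fP (n, st n).
have mS n : (m n < m n.+1)%N by have [] := fP (n, st n).
have ac n (c : int) : (`|c| <= 2 ^ n)%N -> W (m n.+1).+1 (a n *~ c).
  by have [_ _ _] := fP (n, st n); exact.
have m_ge n : (n <= m n)%N by elim: n => // n /leq_ltn_trans; apply.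
have sumE (c : nat -> int) n : (forall i, (`|c i| <= 2 ^ i)%N) ->
    \sum_(0 <= i < n) a i *~ c i \in (st n).1.
  move=> cP; elim: n => [|n IH]; first by rewrite big_nil mem_head.
  rewrite big_nat_recr//; apply/allpairsPdep.
  by exists (\sum_(0 <= i < n) a i *~ c i), (c n); split=> //; exact: mem_int_range.
have tail (c : nat -> int) k l : (forall i, (`|c i| <= 2 ^ i)%N) ->
    W (m k.+1) (\sum_(k <= i < k + l) a i *~ c i).
  move=> cP; elim: l k => [|l IH] k; first by rewrite addn0 big_geq.
  rewrite big_ltn ?addnS ?ltnS ?leq_addr// -addSn.
  by apply: WD; [exact: ac|apply: W_le (IH k.+1); exact: mS].
pose coef k (c : nat -> int) n := (forall i, `|c i| * 2 ^ k <= 2 ^ i)%N /\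
  forall i, (n <= i)%N -> c i = 0.
pose U k : set G := [set x | exists (c : nat -> int) n,
  coef k c n /\ x = \sum_(0 <= i < n) a i *~ c i].
have coef0 k c n i : coef k c n -> (`|c i| <= 2 ^ i)%N.
  by case=> /(_ i) + _; apply: leq_trans; rewrite leq_pmulr ?expn_gt0.
(* sums of different lengths are compared by padding with zeros *)
have widen c k n n' : coef k c n -> (n <= n')%N ->
    \sum_(0 <= i < n) a i *~ c i = \sum_(0 <= i < n') a i *~ c i.
  move=> [_ cn] nn'; rewrite [RHS](big_cat_nat (n := n))//=.
  rewrite [X in _ + X]big1_seq ?addr0//.
  by move=> i /andP[_]; rewrite mem_index_iota => /andP[/cn-> _]; rewrite mulr0z.
exists U; split.
- move=> k; exists (fun=> 0), 0%N; split; last by rewrite big_nil.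
  by split=> // i; rewrite absz0 mul0n.
- move=> k _ _ [c [n [cn ->]]] [d [p [dp ->]]].
  exists (fun i => c i - d i), (maxn n p); split; last first.
    rewrite (widen _ _ _ _ cn (leq_maxl _ p)) (widen _ _ _ _ dp (leq_maxr n _)).
    by rewrite -sumrB; apply: eq_bigr => i _; rewrite mulrzBr.
  case: cn dp => c1 c2 [d1 d2]; split=> i; last first.
    by rewrite geq_max => /andP[/c2-> /d2->].
  by move: (c1 i) (d1 i); rewrite !expnS; nia.
- move=> k x [c [n [cn ->]]].
  rewrite (widen _ _ _ _ cn (leq_addl k n)) (big_cat_nat (n := k)) ?leq_addr//=.
  rewrite big1_seq ?add0r.
    apply: W_le (tail c k n _); first exact: leq_trans (ltnW (mS k)).
    by move=> i; exact: coef0 cn.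
  move=> i /andP[_]; rewrite mem_index_iota => /andP[_ ik].
  have : (`|c i| * 2 ^ k <= 2 ^ i)%N by case: cn.
  have ik2 : (2 ^ i < 2 ^ k)%N by rewrite ltn_exp2l.
  case: (c i) => [[|l]|l] /=; rewrite ?mulr0z// => h; nia.
- move=> k; exists (a k) => //.
  exists (fun i => (i == k)%:Z), k.+1; split.
    split=> i; last by case: eqP => // ->; rewrite ltnn.
    by case: eqP => [->|_]; rewrite ?mul1n// mul0n.
  rewrite big_nat_recr//= eqxx mulr1z big1_seq ?add0r//.
  move=> i /andP[_]; rewrite mem_index_iota => /andP[_ ik].
  by rewrite ltn_eqF// mulr0z.
- move=> n; have [_ _ [b Wb bE] _] := fP (n, st n).
  exists b; first exact: W_le Wb.
  move=> [c [p [cp be]]]; have cP i := coef0 _ _ _ i cp.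
  apply: (bE _ (sumE c n cP)) => /=.
  rewrite be (widen _ _ _ _ cp (leq_addl n p)) (big_cat_nat (n := n)) ?leq_addr//=.
  by rewrite addrAC subrr add0r; exact: tail.
Qed.

End SparseRefinement.

(** Otherwise the refinement given by [sparse_refinement] contradicts
    maximality. *)
Lemma maximal_not_countable_base (G : zmodType) (S : set (set G)) :
    group_filter S -> \bigcap_(U in S) U `<=` [set 0] -> ~ S [set 0] ->
    (forall M, group_filter M -> S `<=` M -> ~ M [set 0] -> M = S) ->
  ~ countable_base S.
Proof.
move=> gS sepS nS maxS [V SV Vb]; have [FS S0 SB] := gS.
have /choice[v vP] : forall A, exists B, S A -> S B /\
    forall x y, B x -> B y -> A (x - y) /\ A (x + y).
  move=> A; have [SA|] := pselect (S A); last by exists setT.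
  by have [B SB' BA] := group_filterBD gS SA; exists B.
pose W := fix W n := if n is k.+1 then v (W k `&` V k) else setT.
have SW n : S (W n).
  elim: n => [|n IH]; first exact: filterT.
  by have [] := vP _ (filterI IH (SV n)).
have Wsub n : W n.+1 `<=` V n.
  move=> x Wx; have [_ /(_ x 0)] := vP _ (filterI (SW n) (SV n)).
  by rewrite subr0 => -[//|/=|[]//]; exact: (S0 _ (SW n.+1)).
have Wbase U : S U -> exists n, W n `<=` U.
  by move=> /Vb[n nU]; exists n.+1; exact: subset_trans nU.
have [|||||U [U0 UB UW Und nU]] := @sparse_refinement G W.
- by move=> n; exact: S0.
- move=> n x y Wx Wy.
  by have [_ /(_ x y Wx Wy)[[]]] := vP _ (filterI (SW n) (SV n)).
- move=> n x y Wx Wy.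
  by have [_ /(_ x y Wx Wy)[_ []]] := vP _ (filterI (SW n) (SV n)).
- move=> x Wx; apply: sepS => A /Wbase[n]; exact.
- move=> n; apply: contrapT => h; apply: nS; apply: filterS (SW n) => x Wx.
  by apply: contrapT => x0; apply: h; exists x.
have US : seq_filter U = S.
  apply: maxS; first exact: seq_filter_group_filter.
    by move=> A /Wbase[n nA]; exists n; exact: subset_trans nA.
  by move=> [n nU0]; have [x /nU0] := Und n.
have [n WU] : exists n, W n `<=` U 0%N.
  by apply: Wbase; rewrite -US; exists 0%N.
by have [x /WU] := nU n.
Qed.

(** * Characters with values in the rationals modulo the integers *)

Section Characters.
Context {G : zmodType}.
Implicit Types (A B : set (G * rat)) (x y g : G).

(** The graph of a homomorphism from a subgroup of [G] to the rationals
    modulo the integers, as the subgroup of all pairs [(x, r)] where [r]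
    represents the value at [x]. *)
Definition partial_character A : Prop :=
  [/\ A (0, 1), forall p q, A p -> A q -> A (p - q) &
      forall r, A (0, r) -> r \is a Num.int].

(** A homomorphism to the rationals modulo the integers, given by
    representatives of its values. *)
Definition character (chi : G -> rat) : Prop :=
  forall x y, chi (x - y) - (chi x - chi y) \is a Num.int.

Lemma partial_character0 A : partial_character A -> A 0.
Proof. by move=> [A1 AB _]; rewrite -[0](subrr (0, 1)); exact: AB. Qed.

Lemma partial_characterMz A p (k : int) :
  partial_character A -> A p -> A (p *~ k).
Proof.
move=> cA Ap; have A0 := partial_character0 cA; have [_ AB _] := cA.
have AN q : A q -> A (- q) by move=> Aq; rewrite -[- q]sub0r; exact: AB.
have An n : A (p *+ n).
  elim: n => [|n IH]; first by rewrite mulr0n.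
  by rewrite mulrSr -[X in _ + X]opprK; apply: AB => //; exact: AN.
by case: k => n; [exact: An|apply: AN; exact: An].
Qed.

Lemma pair_mulrz x (r : rat) (k : int) : (x, r) *~ k = (x *~ k, r *~ k).
Proof.
rewrite [LHS]surjective_pairing.
by rewrite (raddfMz (@fst G rat)) (raddfMz (@snd G rat)).
Qed.

(** Divisibility of the rationals modulo the integers. If [n] is the least
    positive integer with [x *+ n] in the domain, the value at [x] may be any
    [r] with [r *+ n] the prescribed value at [x *+ n]. If there is no such [n],
    any value will do. In both cases it can be chosen nonzero. *)
Lemma partial_character_extend A x :
    partial_character A -> (forall r, ~ A (x, r)) ->
  exists B r, [/\ partial_character B, A `<=` B, B (x, r) & r \isn't a Num.int].
Proof.
move=> cA nAx; have A0 := partial_character0 cA; have [A1 AB Aint] := cA.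
have AN q : A q -> A (- q) by move=> Aq; rewrite -[- q]sub0r; exact: AB.
have AD p q : A p -> A q -> A (p + q).
  by move=> Ap Aq; rewrite -[q]opprK; apply: AB => //; exact: AN.
suff [r [rint rP]] : exists r, r \isn't a Num.int /\
    forall (k : int) s, A (x *~ k, s) -> s - r * k%:~R \is a Num.int.
  exists [set p | exists (k : int) a, A a /\ p = a + (x, r) *~ k], r; split=> //.
  - split.
    + by exists 0, (0, 1); rewrite mulr0z addr0.
    + move=> _ _ [k [a [Aa ->]]] [l [b [Ab ->]]].
      exists (k - l), (a - b); split; first exact: AB.
      by rewrite mulrzBr opprD addrACA.
    + move=> s [k [[g t] [Aa]]] /eqP; rewrite pair_mulrz xpair_eqE /= => /andP[].
      rewrite addrC eq_sym addr_eq0 => /eqP xg /eqP->.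
      have := rP k (- t); rewrite xg => /(_ (AN _ Aa)).
      by rewrite -opprD rpredN mulrzr.
  - by move=> a Aa; exists 0, a; rewrite mulr0z addr0.
  - by exists 1, 0; rewrite mulr1z add0r.
have [[n [n0 [s As]]]|noM] :=
    pselect (exists n, (0 < n)%N /\ exists s, A (x *+ n, s)); last first.
  exists (1 / 2%:R); split=> // k s Aks.
  have k0 : k = 0.
    apply: contrapT => /eqP k0; apply: noM; exists `|k|%N.
    rewrite absz_gt0; split=> //.
    case: (lerP 0 k) => kp; first by exists s; rewrite pmulrn gez0_abs.
    by exists (- s); rewrite pmulrn ltz0_abs// mulrNz; exact: (AN _ Aks).
  by rewrite k0 mulr0 subr0; apply: Aint; rewrite -(mulr0z x) -k0.
pose P n := `[< (0 < n)%N /\ exists s, A (x *+ n, s) >].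
have exP : exists n, P n by exists n; apply/asboolP; split=> //; exists s.
case: (ex_minnP exP) => {exP n0 As s}n /asboolP[n0 [s As]] minn.
have n1 : (1 < n)%N.
  rewrite ltn_neqAle n0 andbT; apply/eqP => n1.
  by apply: (nAx s); rewrite -n1 mulr1n in As.
have nR : n%:R != 0 :> rat by rewrite pnatr_eq0 -lt0n.
have dvd (k : int) t : A (x *~ k, t) -> exists q : int, k = q * n%:Z.
  move=> Ak; exists (k %/ n)%Z.
  have rn := divz_eq k n.
  have [r rE] : exists r : nat, (k %% n)%Z = r%:Z.
    by exists `|(k %% n)%Z|%N; rewrite gez0_abs// modz_ge0// -lt0n.
  have rlt : (r < n)%N by rewrite -ltz_nat -rE ltz_pmod.
  have [r0|r0] := posnP r; first by rewrite {1}rn rE r0 addr0.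
  suff : (n <= r)%N by rewrite leqNgt rlt.
  apply: minn; apply/asboolP; split=> //.
  exists (t - s *~ (k %/ n)%Z).
  have -> : x *+ r = x *~ k - (x *+ n) *~ (k %/ n)%Z.
    rewrite {1}rn rE mulrzDr (mulrC (k %/ n)%Z) mulrzA pmulrn addrAC.
    by rewrite -[x *~ n]/(x *+ n) subrr add0r.
  have := partial_characterMz (k %/ n)%Z cA As => Asq.
  by have := AB _ _ Ak Asq; rewrite pair_mulrz.
have key s' : A (x *+ n, s') -> forall (k : int) t, A (x *~ k, t) ->
    t - s' / n%:R * k%:~R \is a Num.int.
  move=> As' k t Ak; have [q kq] := dvd k t Ak.
  rewrite kq intrM [_%:~R * _]mulrC mulrA -[n%:~R]/(n%:R : rat) divfK//.
  apply: Aint; have := AB _ _ Ak (partial_characterMz q cA As').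
  rewrite pair_mulrz; congr A; apply/eqP; rewrite xpair_eqE /=.
  rewrite kq mulrC mulrzA -[x *~ n]/(x *+ n) subrr eqxx /=.
  by rewrite mulrzr.
(* [s / n] and [(s + 1) / n] are both admissible and not both integers *)
have [sint|sint] := boolP (s / n%:R \is a Num.int); last first.
  by exists (s / n%:R); split=> //; exact: key.
exists ((s + 1) / n%:R); split; last first.
  apply: key; have := AD _ _ As A1.
  by congr A; apply/eqP; rewrite xpair_eqE /= addr0 !eqxx.
apply/negP => s1int; have : n%:R^-1 \is a @Num.int rat.
  have -> : n%:R^-1 = (s + 1) / n%:R - s / n%:R :> rat by field.
  exact: rpredB.
move=> /intrP[z zE].
have : (z * n%:Z)%:~R = 1%:~R :> rat by rewrite intrM -zE mulVf.
move=> /intr_inj/(congr1 absz); rewrite abszM => /eqP; rewrite muln_eq1.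
by move=> /andP[_ /eqP/= nE]; rewrite nE in n1.
Qed.

(** Start from the trivial character on the zero subgroup, give it a nonzero
    value at [g], and extend it to [G] by Zorn's lemma. *)
Lemma separating_character g : g <> 0 ->
  exists2 chi, character chi & chi g \isn't a Num.int.
Proof.
move=> g0.
have c0 : partial_character [set p : G * rat | p.1 = 0 /\ p.2 \is a Num.int].
  split=> //=.
  - by move=> p q [p0 pi] [q0 qi]; rewrite p0 q0 subr0; split=> //; exact: rpredB.
  - by move=> r [].
have [|A [r [cA _ Agr rint]]] := partial_character_extend (x := g) c0.
  by move=> r [].
have [|B [cB AB maxB]] := @Zorn_above _ partial_character A cA.
  move=> F FC [X FX] Ftot; split.
  - by exists X => //; have [] := FC _ FX.
  - move=> p q [Y FY Yp] [Z FZ Zq].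
    have [YZ|ZY] := Ftot Y Z FY FZ.
      by exists Z => //; have [_ + _] := FC _ FZ; apply=> //; exact: YZ.
    by exists Y => //; have [_ + _] := FC _ FY; apply=> //; exact: ZY.
  - by move=> s [Y /FC[_ _]]; exact.
have /choice[chi chiP] : forall x, exists r, B (x, r).
  move=> x; apply: contrapT => /forallNP nBx.
  have [C [s [cC BC Cx _]]] := partial_character_extend cB nBx.
  by apply: (nBx s); rewrite -(maxB C cC BC).
have [_ BB Bint] := cB.
have uniq x s t : B (x, s) -> B (x, t) -> s - t \is a Num.int.
  move=> Bs Bt; apply: Bint; have := BB _ _ Bs Bt.
  by congr B; apply/eqP; rewrite xpair_eqE /= subrr !eqxx.
exists chi.
  move=> x y; apply: (uniq (x - y)); first exact: chiP.
  exact: (BB _ _ (chiP x) (chiP y)).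
apply: contraNN rint => chig.
by rewrite -[r](subrK (chi g)) rpredD//; apply: (uniq g) => //; exact: AB.
Qed.

End Characters.

(** * A metrizable nondiscrete Hausdorff group topology *)

Definition near_int (n : nat) (r : rat) : Prop :=
  exists z : int, `|r - z%:~R| * 2 ^+ n < 1.

Lemma near_intB n r s : near_int n.+1 r -> near_int n.+1 s -> near_int n (r - s).
Proof.
move=> [z hz] [w hw]; exists (z - w).
rewrite intrB; have -> : r - s - (z%:~R - w%:~R) = (r - z%:~R) - (s - w%:~R) by ring.
have : `|r - z%:~R - (s - w%:~R)| <= `|r - z%:~R| + `|s - w%:~R| by exact: ler_normB.
rewrite !exprS in hz hw.
have : 0 < 2 ^+ n :> rat by rewrite exprn_gt0.
by move: (2 ^+ n) (`|_ - (_ - _)|) (`|r - _|) (`|s - _|) hz hw => e u v w'; nra.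
Qed.

Lemma near_intD_int n r i : i \is a Num.int -> near_int n r -> near_int n (i + r).
Proof.
move=> /intrP[w ->] [z hz]; exists (w + z).
by rewrite intrD opprD addrACA subrr add0r.
Qed.

Lemma near_intS n m r : (n <= m)%N -> near_int m r -> near_int n r.
Proof.
move=> nm [z hz]; exists z; apply: le_lt_trans hz.
by apply: ler_wpM2l => //; rewrite ler_weXn2l// ler1n.
Qed.

(** A rational that is not an integer has distance at least
    [1 / denq r] from the integers, and [2 ^ n] exceeds [denq r] for
    [n = denq r]. *)
Lemma near_int_all r : (forall n, near_int n r) -> r \is a Num.int.
Proof.
move=> /(_ `|denq r|%N)[z].
have d0 : 0 < (denq r)%:~R :> rat by rewrite ltr0z denq_gt0.
have rE : r * (denq r)%:~R = (numq r)%:~R by rewrite numqE.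
have dle : (denq r)%:~R <= 2 ^+ `|denq r|%N :> rat.
  have -> : (denq r)%:~R = `|denq r|%N%:R :> rat.
    by rewrite -[denq r in LHS]gez0_abs// denq_ge0.
  by rewrite -natrX ler_nat ltnW// ltn_expl.
move=> hz.
have : `|r - z%:~R| * (denq r)%:~R < 1.
  by apply: le_lt_trans hz; exact: ler_wpM2l.
rewrite -[X in _ * X]gtr0_norm// -normrM mulrBl rE -intrM -intrB -intr_norm.
rewrite -[1]/(1%:~R) ltr_int.
rewrite -[X in _ < X]add0r ltzD1 normr_le0 subr_eq0 => /eqP nE.
by rewrite -[r]divq_num_den nE intrM mulfK ?rpred_int// gt_eqF.
Qed.

(** The index of the interval of length [2 ^- n] that contains the
    fractional part of [r]. It is less than [2 ^ n]; the successor in the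
    type only makes [inord] available. *)
Definition int_cell (n : nat) (r : rat) : 'I_(2 ^ n).+1 :=
  inord `|Num.floor ((r - (Num.floor r)%:~R) * 2 ^+ n)|.

Lemma int_cell_near n r s : int_cell n r = int_cell n s -> near_int n (r - s).
Proof.
pose e (u : rat) := (u - (Num.floor u)%:~R) * 2 ^+ n.
have n0 : 0 < 2 ^+ n :> rat by rewrite exprn_gt0.
have e_ge0 u : 0 <= e u.
  by apply: mulr_ge0; [rewrite subr_ge0 Num.Theory.floor_le|exact: ltW].
have cellE u : int_cell n u = `|Num.floor (e u)|%N :> nat.
  rewrite inordK// ltnS -lez_nat gez0_abs ?floor_ge0 ?e_ge0//.
  rewrite -(ler_int rat); apply: le_trans (Num.Theory.floor_le _) _.
  rewrite -[(_ ^ _)%N%:~R]/((2 ^ n)%N%:R : rat) natrX ler_piMl ?(ltW n0)//.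
  by have := Num.Theory.floorD1_gt u; rewrite intrD lerBlDl => /ltW.
move=> /(congr1 val) /=; rewrite !cellE => /(congr1 Posz).
rewrite !gez0_abs ?floor_ge0 ?e_ge0// => fl.
exists (Num.floor r - Num.floor s); rewrite -[X in _ * X]gtr0_norm// -normrM.
have -> : (r - s - (Num.floor r - Num.floor s)%:~R) * 2 ^+ n = e r - e s.
  by rewrite intrB /e; ring.
have [r1 r2] := (Num.Theory.floor_le (e r), Num.Theory.floorD1_gt (e r)).
have [s1 s2] := (Num.Theory.floor_le (e s), Num.Theory.floorD1_gt (e s)).
rewrite fl in r1 r2; rewrite intrD in r2 s2.
by rewrite ltr_norml; apply/andP; split; lra.
Qed.

Lemma near_int_pigeonhole (phi : nat -> nat -> rat) n :
  exists x y, x <> y /\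
    forall i, (i < n)%N -> near_int n (phi i x - phi i y).
Proof.
pose cell x : {ffun 'I_n -> 'I_(2 ^ n).+1} := [ffun i => int_cell n (phi (val i) x)].
pose N := #|{: {ffun 'I_n -> 'I_(2 ^ n).+1}}|.
have [/injectiveP inj|] := boolP (injectiveb (fun x : 'I_N.+1 => cell (val x))).
  by have := leq_card _ inj; rewrite card_ord ltnn.
move=> /injectivePn[x [y xy cxy]]; exists (val x), (val y); split.
  by move=> /val_inj/eqP; exact/negP.
move=> i ni; apply: int_cell_near.
by have /ffunP/(_ (Ordinal ni)) := cxy; rewrite !ffunE.
Qed.

Lemma infinite_set_inj (T : Type) : infinite_set [set: T] ->
  exists h : nat -> T, injective h.
Proof.
move=> /infiniteP/card_leP[f].
pose u (n : nat) : set_type [set: nat] := SigSub (mem_set (I : [set: nat] n)).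
exists (fun n => val (f (u n))) => m n /val_inj /(@inj _ _ _ f) e.
by have /(congr1 val) := e (in_setT _) (in_setT _).
Qed.

(** The topology lives on the subgroup [range f] generated by countably many
    distinct points [h n], and is induced there by characters [chi n], one for
    each nonzero element [f c]. The [h n] are infinitely many, so two of
    them cannot be told apart by finitely many characters up to a given
    precision; their difference is a nonzero point of a given
    neighbourhood. *)
Lemma exists_nondiscrete_group_filter (G : zmodType) :
    infinite_set [set: G] ->
  exists R : set (set G), [/\ group_filter R, countable_base R,
    \bigcap_(U in R) U `<=` [set 0] & ~ R [set 0]].
Proof.
move=> /infinite_set_inj[h hinj].
pose f (c : seq (int * nat)) := \sum_(p <- c) h p.2 *~ p.1.
have fB c d : f c - f d = f (c ++ [seq (- p.1, p.2) | p <- d]).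
  rewrite /f big_cat big_map -sumrN; congr (_ + _).
  by apply: eq_bigr => p _; rewrite mulrNz.
have fh n : f [:: (1, n)] = h n by rewrite /f big_seq1 mulr1z.
have /choice[chi /all_and2[chiC chiP]] : forall n, exists chi : G -> rat,
    character chi /\ forall c, unpickle n = Some c -> f c <> 0 ->
      chi (f c) \isn't a Num.int.
  move=> n; case E: (unpickle n) => [c|]; last first.
    exists (fun=> 0); split=> // x y; rewrite !subrr; exact: rpred0.
  have [fc0|/separating_character[chi chiC chic]] := pselect (f c = 0).
    exists (fun=> 0); split=> [x y|d [<-] //]; rewrite !subrr; exact: rpred0.
  by exists chi; split=> // d [<-].
pose U n : set G := [set x | range f x /\
  forall i, (i < n)%N -> near_int n (chi i x)].
have chi0 i : chi i 0 \is a Num.int.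
  by have := chiC i 0 0; rewrite !subrr subr0.
have U0 n : U n 0.
  split; first by exists [::] => //; rewrite /f big_nil.
  move=> i _; have /intrP[z zE] := chi0 i.
  by exists z; rewrite zE subrr normr0 mul0r.
have UB n x y : U n.+1 x -> U n.+1 y -> U n (x - y).
  move=> [[c _ <-] xn] [[d _ <-] yn]; split.
    by rewrite fB; exists (c ++ [seq (- p.1, p.2) | p <- d]).
  move=> i ni; rewrite -[chi i _](subrK (chi i (f c) - chi i (f d))).
  apply: near_intD_int; first exact: chiC.
  by apply: near_intB; [apply: xn|apply: yn]; exact: ltnW.
exists (seq_filter U); split.
- exact: seq_filter_group_filter.
- exact: seq_filter_countable_base.
- move=> x Ux; apply: contrapT => x0.
  have Un n : U n x by apply: Ux; exists n.
  have [[c _ cx] _] := Un 0%N.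
  have := chiP (pickle c) c (pickleK c); rewrite cx => /(_ x0)/negP; apply.
  apply: near_int_all => n.
  have [_ /(_ (pickle c) (leq_maxr n _))] := Un (maxn n (pickle c).+1).
  by apply: near_intS; exact: leq_maxl.
- move=> [n nU0].
  have [i [j [ij ijn]]] := near_int_pigeonhole (fun i j => chi i (h j)) n.
  apply: ij; apply: hinj; apply/eqP; rewrite -subr_eq0; apply/eqP.
  apply: nU0; split.
    by rewrite -(fh i) -(fh j) fB; eexists.
  move=> k kn; rewrite -[chi k _](subrK (chi k (h i) - chi k (h j))).
  by apply: near_intD_int; [exact: chiC|exact: ijn].
Qed.

(** * Group topologies and their filters of neighbourhoods of zero *)

(* the name is also used for vector spaces *)
Local Notation space := Defs.space.

Section NbhsZero.
Context {G : zmodType}.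
Implicit Types (tau sigma : group_topology G) (U V : set G) (N : set (set G)).

Definition nbhs0 tau : set (set G) := nbhs (0 : space tau).

Lemma nbhs_shift tau (x y : G) U :
  nbhs (x + y : space tau) U -> nbhs (y : space tau) [set z | U (x + z)].
Proof.
have /asboolP[addC _] := gt_topologyP tau.
move=> /(addC (x, y))[[A B] /= [Ax By] AB].
apply: filterS By => z Bz; apply: (AB (x, z)); split=> //=.
exact: nbhs_singleton Ax.
Qed.

Lemma nbhs_nbhs0 tau (x : G) U :
  nbhs (x : space tau) U <-> nbhs0 tau [set y | U (x + y)].
Proof.
split=> [Ux|U0]; first by apply: nbhs_shift; rewrite addr0.
have := @nbhs_shift tau (- x) x [set y | U (x + y)].
rewrite addNr => /(_ U0); congr nbhs.
by apply/funext => z /=; rewrite addNKr.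
Qed.

Lemma nbhs0_group_filter tau : group_filter (nbhs0 tau).
Proof.
have /asboolP[addC oppC] := gt_topologyP tau; split.
- exact: (@nbhs_filter (space tau) (0 : G)).
- by move=> U; exact: nbhs_singleton.
- move=> U U0; have /(addC (0, 0))[[A B] /= [A0 B0] AB] :
      nbhs ((0 : G) + 0 : space tau) U by rewrite addr0.
  have C0 : nbhs (0 : space tau) [set z | B (- z)].
    by apply: (oppC (0 : space tau)); rewrite /= oppr0.
  exists (A `&` [set z | B (- z)]); first exact: filterI.
  by move=> x y [Ax _] [_ By]; exact: (AB (x, - y)).
Qed.

Lemma nbhs0_le tau sigma :
  (tau <= sigma)%O <-> nbhs0 tau `<=` nbhs0 sigma.
Proof.
split=> [/group_topology_le ts U|ts].
  rewrite /nbhs0 !nbhsE => -[V [oV V0] VU]; exists V => //; split=> //.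
  exact: ts.
apply/group_topology_le => U oU.
change (@open (space sigma) U); rewrite openE => x Ux.
rewrite /interior /=; apply/nbhs_nbhs0; apply: ts; apply: (nbhs_nbhs0 tau x U).1.
by apply: (@open_nbhs_nbhs (space tau)); split.
Qed.

Lemma nbhs0_inj tau sigma : nbhs0 tau = nbhs0 sigma -> tau = sigma.
Proof. by move=> e; apply/le_anti/andP; split; apply/nbhs0_le; rewrite e. Qed.

Lemma nbhs0_discrete tau : nbhs0 tau [set 0] <-> tau = gt_discrete G.
Proof.
split=> [t0|->]; last by apply: open_nbhs_nbhs.
apply/le_anti; rewrite le_gt_discrete /=; apply/nbhs0_le => U /nbhs_singleton U0.
have [FN _ _] := nbhs0_group_filter tau.
by apply: filterS t0 => _ ->.
Qed.

(** A set is declared open when it is a neighbourhood of each of its points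
    [x], in the sense that its translate by [- x] belongs to [N]. *)
Lemma group_filter_nbhs0 N : group_filter N -> exists tau, nbhs0 tau = N.
Proof.
move=> gN; have [FN N0 NB] := gN.
pose op : set (set G) := [set U | forall x, U x -> N [set y | U (x + y)]].
have opP : `[< is_topology op >].
  apply/asboolP; split.
  - by move=> x _; exact: filterT.
  - by move=> U V oU oV x [Ux Vx]; apply: filterI; [exact: oU|exact: oV].
  - move=> F Fop x [U FU Ux]; apply: filterS (Fop U FU x Ux) => y Uy.
    by exists U.
pose t := Topology opP.
have nbhsP (x : G) U : nbhs (x : space t) U <-> N [set y | U (x + y)].
  rewrite nbhsE; split.
    by move=> [V [oV Vx] VU]; apply: filterS (oV x Vx) => y; exact: VU.
  (* the interior of [U] *)
  move=> NU; exists [set z | N [set y | U (z + y)]].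
    split=> //; rewrite space_openE => z /(group_filterBD gN)[V NV VU].
    apply: (filterS _ NV) => y Vy; apply: (filterS _ NV) => w Vw.
    by rewrite /= -addrA; exact: (VU _ _ _ _).2.
  by move=> z /N0 /=; rewrite addr0.
have tP : `[< is_group_topology t >].
  apply/asboolP; split.
    move=> [x y] U /nbhsP /(group_filterBD gN)[V NV VU].
    have nV (z : G) : nbhs (z : space t) [set w | V (w - z)].
      by apply/nbhsP; apply: (filterS _ NV) => w; rewrite /= addrC addKr.
    exists ([set w | V (w - x)], [set w | V (w - y)]); first by split; exact: nV.
    move=> [x' y'] /= [Vx Vy]; have := (VU _ _ Vx Vy).2.
    by congr U; rewrite /= [x' - x + _]addrACA -opprD [LHS]addrC subrK.
  move=> x U /nbhsP /NB[V NV VU]; apply/nbhsP; apply: (filterS _ NV) => y Vy /=.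
  by rewrite opprD -[- y]sub0r; apply: VU => //; exact: N0.
exists (GroupTopology tP); apply/seteqP; split=> U.
  by move=> /nbhsP; congr N; apply/funext => y /=; rewrite add0r.
by move=> NU; apply/nbhsP; move: NU; congr N; apply/funext => y /=; rewrite add0r.
Qed.

Lemma nbhs0_hausdorff tau :
  \bigcap_(U in nbhs0 tau) U `<=` [set 0] -> gt_hausdorff tau.
Proof.
move=> sep p q pq; apply/eqP; rewrite -subr_eq0; apply/eqP/sep => U.
move=> /(group_filterB (nbhs0_group_filter tau))[V [V0 _ VU]].
have nV (z : G) : nbhs (z : space tau) [set w | V (w - z)].
  apply/nbhs_nbhs0; move: V0; congr nbhs0; apply/funext => w.
  by rewrite /= addrC addKr.
have [w [/= Vp Vq]] := pq _ _ (nV p) (nV q).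
by have := VU _ _ Vq Vp; rewrite opprB addrC addrA subrK.
Qed.

Lemma gt_hausdorff_le tau sigma :
  (tau <= sigma)%O -> gt_hausdorff tau -> gt_hausdorff sigma.
Proof.
move=> ts ht p q pq; apply: ht => A B Ap Bq.
apply: pq; apply/nbhs_nbhs0; apply: ((nbhs0_le tau sigma).1 ts);
  exact: (nbhs_nbhs0 tau _ _).1.
Qed.

End NbhsZero.

(** * Chains in partially ordered sets *)

Section Chains.
Context {d : Order.disp_t} {P : porderType d}.
Implicit Types (C X : set P).

Lemma infinite_no_max X : X !=set0 ->
  (forall x, X x -> exists2 y, X y & (x < y)%O) -> infinite_set X.
Proof.
move=> [x0 Xx0] Xup fX.
have /choice[h hP] : forall x, exists y, X x -> X y /\ (x < y)%O.
  move=> x; have [/Xup[y Xy xy]|] := pselect (X x); first by exists y.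
  by exists x.
pose u n := iter n h x0.
have Xu n : X (u n) by elim: n => //= n /hP[].
have ulex m n : (m < n)%N -> (u m < u n)%O.
  elim: n => // n IH; rewrite ltnS leq_eqVlt => /predU1P[->|/IH um].
    by have [] := hP _ (Xu n).
  by apply: lt_trans um _; have [] := hP _ (Xu n).
have uinj : injective u.
  move=> m n e; case: (ltngtP m n) => // /ulex; by rewrite e ltxx.
apply: infinite_nat; rewrite -(eq_finite_set (inj_card_eq (f := u) _)).
  by apply: sub_finite_set fX => _ [n _ <-].
by move=> m n _ _; exact: uinj.
Qed.

(** A chain that refines the part of [C] above [x] can be glued to [C]: its
    elements are above [x], hence comparable with those of [C]. *)
Lemma nonrefinable_chain_above C x : nonrefinable_chain C -> C x ->
  nonrefinable_chain (C `&` [set y | (x <= y)%O]).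
Proof.
move=> [chC maxC] Cx; split=> [y z [Cy _] [Cz _]|C' chC' [sub btw]].
  exact: chC.
have xC' y : C' y -> (x <= y)%O.
  by move=> /btw[d1 [d2 [[_ xd1] _ + _]]]; exact: le_trans.
have CC' : C `|` C' = C.
  apply: maxC.
    have mixed y z : C y -> C' z -> (y <= z)%O \/ (z <= y)%O.
      move=> Cy Cz; have [xy|yx] := chC _ _ Cx Cy.
        by apply: chC' => //; apply: sub.
      by left; apply: le_trans yx _; exact: xC'.
    move=> y z [Cy|Cy] [Cz|Cz]; [exact: chC|exact: mixed| |exact: chC'].
    by have [|] := mixed _ _ Cz Cy; [right|left].
  split=> [y Cy|y [Cy|/btw[d1 [d2 [[? _] [? _] ? ?]]]]]; first by left.
    by exists y, y.
  by exists d1, d2.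
apply/seteqP; split=> // y C'y; split; last exact: xC'.
by rewrite -CC'; right.
Qed.

Lemma has_length_pair C (a b : P) k :
  has_length C k -> C `<=` [set a; b] -> (k < 2)%N.
Proof.
move=> Ck Cab; rewrite -card_le_II -(card_le_eql Ck).
apply: card_le_trans (subset_card_le Cab) _.
have <- : (fun n => if n is 0%N then a else b) @` `I_2 = [set a; b].
  apply/seteqP; split=> [_ [[|n] _ <-]|x [->|->]]; [by left|by right| |].
    by exists 0%N.
  by exists 1%N.
exact: card_image_le.
Qed.

(** The chain [C] is a maximal chain in [H] through [D], [s] and [t]. Above an
    element below [s] it is infinite, since it contains the elements of [D]
    from some point on, and [D] has no maximum. Above [s] it is contained in
    the pair of [s] and [t]. *)
Lemma exists_chain_without_kth_top (H : set P) (D : set P) (s t : P) :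
    (forall x y, H x -> (x <= y)%O -> H y) ->
    (forall x, (x <= t)%O) ->
    (forall x, (s <= x)%O -> x = s \/ x = t) ->
    D !=set0 -> chain D ->
    (forall x, D x -> H x /\ (x < s)%O) ->
    (forall x, (forall y, D y -> (y <= x)%O) -> (s <= x)%O) ->
  exists C, [/\ infinite_set C, nonrefinable_chain C, C `<=` H,
    has_greatest C t &
    forall x k, C x -> (1 < k)%N ->
      exists E, [/\ nonrefinable_chain E, has_least E x, has_greatest E t &
        ~ has_length E k]].
Proof.
move=> Hup le_t s_max [x0 Dx0] chD DH D_sup.
have [Hx0 x0s] := DH _ Dx0.
have D_up x : D x -> exists2 y, D y & (x < y)%O.
  move=> Dx; have [_ xs] := DH _ Dx; apply: contrapT => noy.
  have : (s <= x)%O.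
    apply: D_sup => y Dy; have [|xy] := chD _ _ Dy Dx => //.
    move: xy; rewrite le_eqVlt => /predU1P[-> //|xy].
    by exfalso; apply: noy; exists y.
  by move=> sx; have := lt_le_trans xs sx; rewrite ltxx.
pose good X := chain X /\ X `<=` H.
have good0 : good (D `|` [set s; t]).
  split; last first.
    move=> x [/DH[]//|[->|->]]; first exact: Hup Hx0 (ltW x0s).
    exact: Hup Hx0 (le_t _).
  move=> x y [Dx|[->|->]] [Dy|[->|->]]; rewrite ?lexx ?le_t; auto.
  - by left; have [_ /ltW] := DH _ Dx.
  - by right; have [_ /ltW] := DH _ Dy.
have [|C [[chC CH] DC maxC]] := Zorn_above good0.
  move=> F Fg _ Ftot; split; last by move=> x [X /Fg[_]]; exact.
  move=> x y [X FX Xx] [Y FY Yy]; have [XY|YX] := Ftot _ _ FX FY.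
    by have [+ _] := Fg _ FY; apply=> //; exact: XY.
  by have [+ _] := Fg _ FX; apply=> //; exact: YX.
have Cs : C s by apply: DC; right; left.
have Ct : C t by apply: DC; right; right.
have nrC : nonrefinable_chain C.
  split=> // C' chC' [CC' btw]; apply: maxC => //; split=> // x /btw.
  by move=> [x1 [x2 [/CH Hx1 _ x1x _]]]; exact: Hup Hx1 x1x.
have Dabove x : ~ (s <= x)%O -> C x ->
    infinite_set (C `&` [set y | (x <= y)%O]).
  move=> nsx Cx; have [y0 Dy0 nyx] : exists2 y, D y & ~ (y <= x)%O.
    apply: contrapT => noy; apply: nsx; apply: D_sup => y Dy.
    by apply: contrapT => nyx; apply: noy; exists y.
  have xy0 : (x <= y0)%O by have [|//] := chC y0 x (DC _ (or_introl Dy0)) Cx.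
  have : infinite_set (D `&` [set y | (x <= y)%O]).
    apply: infinite_no_max; first by exists y0.
    move=> y [Dy xy]; have [z Dz yz] := D_up _ Dy; exists z => //.
    by split=> //; exact: le_trans xy (ltW yz).
  apply: contra_not; apply: sub_finite_set => y [Dy xy].
  by split=> //; apply: DC; left.
exists C; split=> //.
- have Cx0 : C x0 by apply: DC; left.
  have nsx0 : ~ (s <= x0)%O.
    by move=> sx0; have := lt_le_trans x0s sx0; rewrite ltxx.
  by apply: contra_not (Dabove x0 nsx0 Cx0); apply: sub_finite_set => x [].
- by split=> // x _; exact: le_t.
- move=> x k Cx k1; exists (C `&` [set y | (x <= y)%O]); split.
  + exact: nonrefinable_chain_above.
  + by split=> [|y []//]; split=> /=.
  + by split=> [|y _]; [split=> //=; exact: le_t|exact: le_t].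
  have [sx|nsx] := pselect (s <= x)%O.
    move=> /(has_length_pair (a := s) (b := t)) k2.
    suff : (k < 2)%N by rewrite ltnNge k1.
    by apply: k2 => y [_ /= xy]; have [|] := s_max _ (le_trans sx xy); [left|right].
  by move=> Ek; apply: (Dabove _ nsx Cx); exists k.+1.
Qed.

End Chains.

(** * Conclusion *)

Lemma exists_limit_coatom (G : zmodType) : infinite_set [set: G] ->
  exists (sigma : group_topology G) (D : set (group_topology G)),
  [/\ forall tau, (sigma <= tau)%O -> tau = sigma \/ tau = gt_discrete G,
      D !=set0, chain D,
      forall tau, D tau -> gt_hausdorff tau /\ (tau < sigma)%O &
      forall tau, (forall rho, D rho -> (rho <= tau)%O) -> (sigma <= tau)%O].
Proof.
move=> /exists_nondiscrete_group_filter[R [gR cR sepR nR]].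
have [||S [[gS nS] RS maxS]] :=
    @Zorn_above _ (fun M => group_filter M /\ ~ M [set 0]) R.
- by [].
- move=> F Fg F0 Ftot; split; last by move=> [M /Fg[_]].
  by apply: bigcup_group_filter => // M /Fg[].
have ncS : ~ countable_base S.
  apply: maximal_not_countable_base => //.
    by move=> x Sx; apply: sepR => U /RS; exact: Sx.
  by move=> M gM SM nM; apply: maxS.
have [DF [DFP [M0 DM0] DFtot DFS]] := exists_chain_below gS ncS gR cR RS.
have [sigma sE] := group_filter_nbhs0 gS.
exists sigma, [set tau | DF (nbhs0 tau)]; split.
- move=> tau /nbhs0_le; rewrite sE => St.
  have [t0|nt0] := pselect (nbhs0 tau [set 0]); first by right; exact/nbhs0_discrete.
  left; apply: nbhs0_inj; rewrite sE; apply: maxS => //.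
  by split=> //; exact: nbhs0_group_filter.
- have [gM0 _ _ _] := DFP _ DM0; have [tau tE] := group_filter_nbhs0 gM0.
  by exists tau; rewrite /= tE.
- move=> tau rho Dt Dr; have [?|?] := DFtot _ _ Dt Dr.
    by left; exact/nbhs0_le.
  by right; exact/nbhs0_le.
- move=> tau /DFP[_ Rt tS tnS]; split.
    by apply: nbhs0_hausdorff => x tx; apply: sepR => U /Rt; exact: tx.
  rewrite lt_neqAle; apply/andP; split; last by apply/nbhs0_le; rewrite sE.
  by apply/eqP => ts; apply: tnS; rewrite ts.
- move=> tau ub; apply/nbhs0_le; rewrite sE -DFS => U [M DM MU].
  have [gM _ _ _] := DFP _ DM; have [rho rE] := group_filter_nbhs0 gM.
  have /nbhs0_le : (rho <= tau)%O by apply: ub; rewrite /= rE.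
  by rewrite rE; apply.
Qed.

Lemma not_property_P (G : zmodType) k : (2 <= k)%N -> infinite_set [set: G] ->
  ~ property_P G k.
Proof.
move=> k2 /exists_limit_coatom[sigma [D [smax D0 chD DP Dsup]]] PG.
have [C [infC nrC CH Cgr Cshort]] := exists_chain_without_kth_top
  (H := @gt_hausdorff G) (t := gt_discrete G)
  (fun x y Hx xy => gt_hausdorff_le xy Hx) (@le_gt_discrete G) smax D0 chD DP Dsup.
have [tau [Ctau [_ kmax]]] := PG C infC nrC CH Cgr.
have [E [nrE Elst Egr]] := Cshort _ _ Ctau k2.
by apply; exact: kmax.
Qed.

Theorem theorem1p3 :
  (forall G : zmodType, infinite_set [set: G] -> ~ property_P G 2) /\
  (forall k : nat, (2 <= k)%N ->
   forall G : zmodType, infinite_set [set: G] -> ~ property_P G k).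
Proof.
split=> [G|k k2 G]; exact: not_property_P.
Qed.
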